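(* An epr-sequence of order $n$, and starting with $\mathtt{A}$, is attainable by a symmetric matrix over $\mathbb{Z}_2$ if and only if it has one of the following forms: 1. $\mathtt{A}\overline{\mathtt{A}}$; 2. $\mathtt{A}\overline{\mathtt{S}}\mathtt{N}\overline{\mathtt{N}}$; 3. $\mathtt{ASS}\overline{\mathtt{S}}\mathtt{A}$; 4. $\mathtt{ASS}\overline{\mathtt{S}}\mathtt{AA}$; 5. $\mathtt{ASSS}\overline{\mathtt{S}}\mathtt{AN}$ with $n$ even; 6. $\mathtt{ASA}\overline{\mathtt{SA}}$; 7. $\mathtt{ASA}\overline{\mathtt{SA}}\mathtt{A}$; 8. $\mathtt{ASA}\overline{\mathtt{SA}}\mathtt{N}$.
   Context: $\mathbb{Z}_2$ is the field of integers modulo $2$. For an $n\times n$ symmetric matrix $B$ over a field $\mathbb{F}$, the enhanced principal rank characteristic sequence (epr-sequence) is $\operatorname{epr}(B)=\ell_1\ell_2\cdots\ell_n$, where $\ell_k=\mathtt{A}$ if all principal minors of $B$ of order $k$ are nonzero, $\ell_k=\mathtt{S}$ if some but not all principal minors of order $k$ are nonzero, and $\ell_k=\mathtt{N}$ if all principal minors of order $k$ are zero. A finite nonempty sequence over $\{\mathtt{A},\mathtt{S},\mathtt{N}\}$ is attainable over $\mathbb{F}$ if it equals $\operatorname{epr}(B)$ for some symmetric matrix $B$ over $\mathbb{F}$; its order is its length. In a form, an overlined block $\overline{t_1\cdots t_k}$ stands for the block $t_1\cdots t_k$ repeated any number of times $\geq 0$ (so it may be omitted entirely); a sequence ''has a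 form'' if it is obtained by some choice of the repetition numbers, chosen independently for each overlined block. *)

(* Defs.v *)
From mathcomp Require Import all_boot all_algebra.

Set Implicit Arguments.
Unset Strict Implicit.
Unset Printing Implicit Defensive.

Import GRing.Theory.
Local Open Scope ring_scope.

Inductive epr_letter : Type := lA | lS | lN.

Definition principal_submx (F : fieldType) (n : nat) (B : 'M[F]_n)
    (alpha : {set 'I_n}) : 'M[F]_#|alpha| :=
  mxsub (fun i : 'I_#|alpha| => enum_val i) (fun j => enum_val j) B.

Definition principal_minor (F : fieldType) (n : nat) (B : 'M[F]_n)
    (alpha : {set 'I_n}) : F :=
  \det (principal_submx B alpha).

Definition epr_term (F : fieldType) (n : nat) (B : 'M[F]_n) (k : nat) :
    epr_letter :=
  if [forall (alpha : {set 'I_n} | #|alpha| == k), principal_minor B alpha != 0]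
  then lA
  else if [exists (alpha : {set 'I_n} | #|alpha| == k),
             principal_minor B alpha != 0]
  then lS
  else lN.

Definition epr (F : fieldType) (n : nat) (B : 'M[F]_n) : seq epr_letter :=
  [seq epr_term B k | k <- iota 1 n].

(* The sequence is nonempty, which excludes the 0 x 0 matrix. *)
Definition attainable (F : fieldType) (s : seq epr_letter) : Prop :=
  s <> [::] /\ exists (n : nat) (B : 'M[F]_n), B^T = B /\ epr B = s.

(* An overlined block: t repeated m >= 0 times. *)
Definition rep (m : nat) (t : seq epr_letter) : seq epr_letter :=
  flatten (nseq m t).

(* Main.v *)
Require Import Defs.
From mathcomp Require Import all_boot all_algebra.
From mathcomp Require Import zify.

(* Over Z_2 a symmetric matrix B with unit diagonal is I + A(G) for a graph G, and
   x^T B x is the sum of the entries of x.  Hence if B[a] is nonsingular and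
   B[a] v = 1, then deleting i from a keeps the minor nonzero exactly when
   v_i = 1; since v <> 0, a letter N is followed only by Ns.  If all principal
   minors of order m are nonzero, then for every a of order m + 1 the all-ones
   vector on a is either this v or spans the kernel of B[a], so the vertices of
   G[a] have degrees of equal parity.  When 3 <= m <= n - 2, varying a shows that
   all 4-cycle sums vanish, so that G is complete bipartite (all triangle sums are
   zero, one triple being nonsingular); this is also what l_3 = A says.  For
   complete bipartite G the minor of a vanishes exactly when both parts of a are
   odd, which gives the forms starting with ASA.  Otherwise, unless
   l_2 = A and B = I, A can occur after the first letter only in the last two
   positions, and l_{n-1} l_n = AN
   makes the all-ones vector span the kernel, whence n = 1^T B 1 = 0 mod 2.  The
   remaining forms are realized by J + I, P_3 + I, C_4 + I and a cone over C_4 + I. *)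

Set Implicit Arguments.
Unset Strict Implicit.
Unset Printing Implicit Defensive.

Import GRing.Theory.
Local Open Scope ring_scope.

(** * Principal minors through the kernel of a principal submatrix *)

(** Vectors become functions on all of ['I_n], so that [a] and [a :\ i] can share them without
    reindexing along [enum_val]. *)
Lemma extend_row (F : fieldType) (n : nat) (a : {set 'I_n}) (v : 'rV[F]_#|a|) :
  exists x : 'I_n -> F, forall k, x (enum_val k) = v 0 k.
Proof.
exists (fun i => if [pick k | enum_val k == i] is Some k then v 0 k else 0).
move=> k; case: pickP => [l /eqP/enum_val_inj -> //|/(_ k)].
by rewrite eqxx.
Qed.

Lemma principal_minorP (F : fieldType) (n : nat) (B : 'M[F]_n)
    (a : {set 'I_n}) :
  reflect (forall x : 'I_n -> F,
             (forall j, j \in a -> \sum_(i in a) x i * B i j = 0) ->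
             forall i, i \in a -> x i = 0)
          (principal_minor B a != 0).
Proof.
rewrite /principal_minor; apply: (iffP idP) => [/det0P nz x xB i ia|ker0].
  pose v : 'rV[F]_#|a| := \row_k x (enum_val k).
  have v0 : v = 0.
    apply/eqP/negPn/negP => vn0; case: nz; exists v => //.
    apply/rowP => k; rewrite !mxE -[RHS](xB (enum_val k) (enum_valP k)).
    by rewrite [RHS]big_enum_val; apply: eq_bigr => l _; rewrite !mxE.
  have /rowP/(_ (enum_rank_in ia i)) := v0.
  by rewrite !mxE enum_rankK_in.
apply/det0P => -[v vn0 vB]; case/eqP: vn0.
have [x xv] := extend_row v.
apply/rowP => k; rewrite mxE -xv; apply: ker0 (enum_valP k) => j ja.
have /rowP/(_ (enum_rank_in ja j)) := vB; rewrite !mxE => vBj.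
rewrite -[RHS]vBj big_enum_val; apply: eq_bigr => l _.
by rewrite !mxE xv enum_rankK_in.
Qed.

Lemma principal_solve (F : fieldType) (n : nat) (B : 'M[F]_n)
    (a : {set 'I_n}) (y : 'I_n -> F) :
  principal_minor B a != 0 ->
  exists x : 'I_n -> F,
    forall j, j \in a -> \sum_(i in a) x i * B i j = y j.
Proof.
rewrite /principal_minor -unitfE -unitmxE => unitB.
have [x xv] := extend_row ((\row_k y (enum_val k)) *m invmx (principal_submx B a)).
exists x => j ja.
have /rowP/(_ (enum_rank_in ja j)) := mulmxKV unitB (\row_k y (enum_val k)).
rewrite !mxE enum_rankK_in // => <-.
rewrite [LHS]big_enum_val; apply: eq_bigr => l _.
by rewrite xv !mxE enum_rankK_in.
Qed.

(** The difference of the unit vectors at [i] and [j] lies in the kernel. This is the source of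
    nearly all vanishing minors below. *)
Lemma twin_minor (F : fieldType) (n : nat) (B : 'M[F]_n) (a : {set 'I_n})
    (i j : 'I_n) :
  i \in a -> j \in a -> i != j -> (forall l, l \in a -> B i l = B j l) ->
  principal_minor B a = 0.
Proof.
move=> ia ja ij eqB; apply/eqP/negPn/negP => /principal_minorP ker0.
suff xB l : l \in a -> \sum_(k in a) ((k == i)%:R - (k == j)%:R) * B k l = 0.
  have /eqP := ker0 (fun k => (k == i)%:R - (k == j)%:R) xB i ia.
  by rewrite eqxx (negPf ij) subr0 oner_eq0.
move=> la; under eq_bigr do rewrite mulrBl.
rewrite sumrB (bigD1 i) //= (bigD1 j ja) /= !eqxx !mul1r eqB //.
by rewrite !big1 ?addr0 ?subrr // => k /andP[_ /negPf->]; rewrite mul0r.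
Qed.

Lemma independent_minor (F : fieldType) (n : nat) (B : 'M[F]_n)
    (a : {set 'I_n}) :
  (forall i, B i i = 1) ->
  {in a &, forall i j, i != j -> B i j = 0} ->
  principal_minor B a != 0.
Proof.
move=> diagB indep; apply/principal_minorP => x xB i ia.
rewrite -(xB i ia) (bigD1 i) //= diagB mulr1 big1 ?addr0 // => j /andP[ja ji].
by rewrite indep // mulr0.
Qed.

(** * Sets of prescribed order and the meaning of the letters *)

Lemma exists_card_between (T : finType) (a c : {set T}) (k : nat) :
  a \subset c -> (#|a| <= k <= #|c|)%N ->
  exists b : {set T}, [/\ a \subset b, b \subset c & #|b| = k].
Proof.
elim: k => [|k IH] ac /andP[ak kc].
  by exists a; split=> //; apply/eqP; rewrite -leqn0.
have [ak'|ak'] := leqP #|a| k; last first.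
  by exists a; split=> //; apply/eqP; rewrite eqn_leq ak.
have [|b [ab bc bk]] := IH ac; first by rewrite ak' ltnW.
have /properP[_ [x xc xb]] : b \proper c by rewrite properEcard bc bk.
exists (x |: b); split; first exact: subset_trans ab (subsetUr _ _).
  by rewrite subUset sub1set xc.
by rewrite cardsU1 xb bk.
Qed.

Lemma exists_set_card (n k : nat) :
  (k <= n)%N -> exists a : {set 'I_n}, #|a| = k.
Proof.
move=> kn; have [|a [_ _ ak]] := @exists_card_between 'I_n set0 setT k (sub0set _).
  by rewrite cards0 cardsT card_ord.
by exists a.
Qed.

Lemma epr_termA (F : fieldType) (n : nat) (B : 'M[F]_n) (k : nat) :
  epr_term B k = lA <->
  (forall a : {set 'I_n}, #|a| = k -> principal_minor B a != 0).
Proof.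
rewrite /epr_term; case: ifPn => [/forallP h|/forallP nh].
  by split=> // _ a /eqP ak; apply: (implyP (h a)).
split; first by case: ifP.
by move=> h; case: nh => a; apply/implyP => /eqP; apply: h.
Qed.

Lemma epr_termS (F : fieldType) (n : nat) (B : 'M[F]_n) (k : nat) :
  epr_term B k = lS <->
  (exists2 a : {set 'I_n}, #|a| = k & principal_minor B a != 0) /\
  (exists2 a : {set 'I_n}, #|a| = k & principal_minor B a = 0).
Proof.
rewrite /epr_term; case: ifPn => [/forallP h|].
  split=> // -[_ [a /eqP ak a0]].
  by have := implyP (h a) ak; rewrite a0 eqxx.
rewrite negb_forall => /existsP[b]; rewrite negb_imply negbK => /andP[/eqP bk /eqP b0].
case: ifPn => [/existsP[a /andP[/eqP ak a0]]|/existsP ne].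
  by split=> // _; split; [exists a|exists b].
by split=> // -[[a /eqP ak a0] _]; case: ne; exists a; rewrite ak.
Qed.

(** The bound matters: for [k > n] no set has order [k], and [epr_term] is vacuously [lA]. *)
Lemma epr_termN (F : fieldType) (n : nat) (B : 'M[F]_n) (k : nat) :
  (k <= n)%N ->
  epr_term B k = lN <->
  (forall a : {set 'I_n}, #|a| = k -> principal_minor B a = 0).
Proof.
move=> kn; have [c ck] := exists_set_card kn; rewrite /epr_term; case: ifPn => [/forallP h|_].
  split=> // h0; have := h c.
  by rewrite ck eqxx h0 // eqxx.
case: ifPn => [/existsP[a /andP[/eqP ak a0]]|/existsP ne].
  by split=> // h0; rewrite h0 ?eqxx in a0.
split=> // _ a /eqP ak; apply/eqP/negPn/negP => a0.
by case: ne; exists a; rewrite ak.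
Qed.

(** * Quadratic and bilinear forms over the field with two elements *)

Lemma F2_cases (c : 'F_2) : c = 0 \/ c = 1.
Proof. by case: c => -[|[|k]] ltk //; [left|right]; apply/val_inj. Qed.

Lemma addF2 (c : 'F_2) : c + c = 0.
Proof. by apply: addrr_pchar2; exact: pchar_Fp. Qed.

Lemma natr_F2 (k : nat) : k%:R = (odd k)%:R :> 'F_2.
Proof.
rewrite -[in LHS](odd_double_half k) -muln2 mulnC natrD natrM.
by rewrite -[2%:R]/(1 + 1 : 'F_2) addF2 mul0r addr0.
Qed.

Lemma addF2_eq0 (x y : 'F_2) : (x + y == 0) = (x == y).
Proof. by rewrite addr_eq0 oppr_pchar2 ?pchar_Fp. Qed.

(** The terms at [(i, j)] and [(j, i)] are equal and cancel in characteristic 2, leaving the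
    diagonal. *)
Lemma sum_symmetric_F2 (n : nat) (a : {set 'I_n}) (g : 'I_n -> 'I_n -> 'F_2) :
  (forall i j, g i j = g j i) ->
  \sum_(i in a) \sum_(j in a) g i j = \sum_(i in a) g i i.
Proof.
move=> symg.
have split_row i : i \in a -> \sum_(j in a) g i j =
    g i i + (\sum_(j in a | (j < i)%N) g i j + \sum_(j in a | (i < j)%N) g i j).
  move=> ia; rewrite (bigD1 i) //=; congr (_ + _).
  rewrite (bigID (fun j : 'I_n => (j < i)%N)) /=; congr (_ + _).
    apply: eq_bigl => j; rewrite -!andbA; congr (_ && _).
    by apply: andb_idl; apply: contraTneq => ->; rewrite ltnn.
  apply: eq_bigl => j; rewrite -!andbA; congr (_ && _).
  by rewrite -leqNgt [RHS]ltn_neqAle eq_sym.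
rewrite (eq_bigr _ split_row) 2!big_split /=.
rewrite [X in _ + (_ + X)](exchange_big_dep (mem a)) /=; last first.
  by move=> i j _ /andP[].
rewrite -big_split [X in _ + X]big1 ?addr0 //= => i ia.
rewrite (_ : \sum_(j in a | _) g j i = \sum_(j in a | (j < i)%N) g i j) ?addF2 //.
apply: eq_big => [j|j _]; last exact: symg.
by rewrite ia.
Qed.

Definition unit_symmetric (n : nat) (B : 'M['F_2]_n) : Prop :=
  B^T = B /\ forall i, B i i = 1.

Lemma unit_symmetricE (n : nat) (B : 'M['F_2]_n) (i j : 'I_n) :
  unit_symmetric B -> B i j = B j i.
Proof. by case=> symB _; rewrite -{1}symB mxE. Qed.

(** Only the terms [B i i * x i ^ 2] survive, and squaring is the identity on ['F_2]. *)
Lemma quadratic_form_F2 (n : nat) (B : 'M['F_2]_n) (a : {set 'I_n})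
    (x : 'I_n -> 'F_2) :
  unit_symmetric B ->
  \sum_(j in a) (\sum_(i in a) x i * B i j) * x j = \sum_(i in a) x i.
Proof.
move=> usB; under eq_bigr do rewrite mulr_suml.
rewrite sum_symmetric_F2 => [|i j].
  apply: eq_bigr => i _; rewrite (proj2 usB) mulr1.
  by case: (F2_cases (x i)) => ->; rewrite ?mul0r ?mul1r.
by rewrite (unit_symmetricE _ _ usB) mulrAC [in RHS]mulrAC (mulrC (x i)).
Qed.

Lemma bilinear_form_F2 (n : nat) (B : 'M['F_2]_n) (a : {set 'I_n})
    (x y : 'I_n -> 'F_2) :
  unit_symmetric B ->
  \sum_(j in a) (\sum_(i in a) x i * B i j) * y j =
  \sum_(j in a) (\sum_(i in a) y i * B i j) * x j.
Proof.
move=> usB; under eq_bigr do rewrite mulr_suml.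
under [RHS]eq_bigr do rewrite mulr_suml.
rewrite exchange_big; apply: eq_bigr => i _; apply: eq_bigr => j _.
by rewrite (unit_symmetricE _ _ usB) mulrC mulrA mulrAC.
Qed.

(** * Deleting one index from a nonsingular set *)

(** A kernel vector of [B[a :\ i]] is compared with [B[a]] after extension by 0 at [i]. *)
Lemma sum_zero_extension (n : nat) (B : 'M['F_2]_n) (a : {set 'I_n})
    (x : 'I_n -> 'F_2) (i j : 'I_n) :
  i \in a ->
  \sum_(k in a) (if k == i then 0 else x k) * B k j =
  \sum_(k in a :\ i) x k * B k j.
Proof.
move=> ia; rewrite (bigD1 i) //= eqxx mul0r add0r.
apply: eq_big => [k|k /andP[_ /negPf->] //]; by rewrite !inE andbC.
Qed.

(* Since x^T B x is the sum of the entries of x, the diagonal of the inverse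
   of B[a] is the solution v of B[a] v = 1. *)
Lemma minor_setD1 (n : nat) (B : 'M['F_2]_n) (a : {set 'I_n})
    (v : 'I_n -> 'F_2) (i : 'I_n) :
  unit_symmetric B -> principal_minor B a != 0 ->
  (forall j, j \in a -> \sum_(i in a) v i * B i j = 1) -> i \in a ->
  (principal_minor B (a :\ i) != 0) = (v i == 1).
Proof.
move=> usB nza vB ia.
have form1 x : \sum_(j in a) (\sum_(k in a) x k * B k j) * v j
             = \sum_(j in a) x j.
  by rewrite bilinear_form_F2 //; apply: eq_bigr => j ja; rewrite vB ?mul1r.
apply/principal_minorP/eqP => [nzD|vi1 x xB].
  (* [x] is row [i] of the inverse of [B[a]]. Below, [x i] is the quadratic form at [x], hence the
     sum of the entries of [x], hence [v i] by [form1]. If [v i = 0], then [x] restricts to a kernel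
     vector of [B[a :\ i]], so [x = 0], which is absurd. *)
  have [x xB] := principal_solve (fun j => (j == i)%:R) nza.
  have sum_delta y : \sum_(j in a) (\sum_(k in a) x k * B k j) * y j = y i :> 'F_2.
    rewrite (bigD1 i) //= xB // eqxx mul1r big1 ?addr0 // => j /andP[ja ji].
    by rewrite xB // (negPf ji) mul0r.
  case: (F2_cases (v i)) => // vi0.
  have xi0 : x i = 0.
    by rewrite -sum_delta quadratic_form_F2 // -form1 sum_delta.
  have x0 j : j \in a -> x j = 0.
    move=> ja; have [->//|ji] := eqVneq j i.
    apply: nzD; last by rewrite !inE ji.
    move=> k; rewrite !inE => /andP[ki ka].
    have := xB k ka; rewrite (bigD1 i) //= xi0 mul0r add0r (negPf ki) => xk.
    by rewrite -[RHS]xk; apply: eq_bigl => l; rewrite !inE andbC.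
  have /esym/eqP := xB i ia; rewrite eqxx big1 ?oner_eq0 // => j ja.
  by rewrite x0 ?mul0r.
pose y j := if j == i then 0 else x j.
have yBj j : j \in a -> j != i -> \sum_(k in a) y k * B k j = 0.
  by move=> ja ji; rewrite sum_zero_extension // xB // !inE ji.
(* The sum of the entries of [y] is computed twice: paired with [v] it is the entry of [yB] at [i],
   since [v i = 1], and paired with [y] it is 0, since [y i = 0]. *)
have yBi : \sum_(k in a) y k * B k i = 0.
  have := form1 y; rewrite -(quadratic_form_F2 a y usB) (bigD1 i) //= vi1 mulr1.
  rewrite [X in _ + X = _]big1 => [|j /andP[ja ji]]; last by rewrite yBj ?mul0r.
  rewrite addr0 => ->; rewrite big1 // => j ja.
  have [->|ji] := eqVneq j i; first by rewrite /y eqxx mulr0.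
  by rewrite yBj ?mul0r.
move=> j; rewrite !inE => /andP[ji ja].
have /principal_minorP/(_ y) := nza; rewrite /y => /(_ _ j ja).
rewrite (negPf ji); apply=> k ka.
by have [->|ki] := eqVneq k i; [exact: yBi|exact: yBj].
Qed.

Lemma nonzero_minor_setD1 (n : nat) (B : 'M['F_2]_n) (a : {set 'I_n}) :
  unit_symmetric B -> a != set0 -> principal_minor B a != 0 ->
  exists2 i, i \in a & principal_minor B (a :\ i) != 0.
Proof.
move=> usB /set0Pn[j ja] nza.
have [v vB] := principal_solve (fun=> 1) nza.
have [/existsP[i /andP[ia vi]]|/existsPn no] := boolP [exists i, (i \in a) && (v i == 1)].
  by exists i; rewrite ?(minor_setD1 usB nza vB).
have /esym/eqP := vB j ja; rewrite big1 ?oner_eq0 // => i ia.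
have := no i; rewrite ia /= => vi.
by case: (F2_cases (v i)) vi => ->; rewrite ?mul0r.
Qed.

Lemma nonzero_minor_le (n : nat) (B : 'M['F_2]_n) (a : {set 'I_n}) (k : nat) :
  unit_symmetric B -> principal_minor B a != 0 -> (k <= #|a|)%N ->
  exists2 b : {set 'I_n}, #|b| = k & principal_minor B b != 0.
Proof.
move=> usB; move: {2}(#|a|) (erefl #|a|) => m; elim: m a => [|m IH] a am nza ka.
  by exists a => //; move: ka; rewrite am leqn0 => /eqP.
have [ak|] := eqVneq k #|a|; first by exists a.
move=> neka; have ltka : (k < #|a|)%N by rewrite ltn_neqAle neka.
have [|i ia nzD] := nonzero_minor_setD1 usB _ nza.
  by rewrite -card_gt0 am.
have cD : #|a :\ i| = m by have := cardsD1 i a; rewrite ia am => -[].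
by apply: (IH (a :\ i)) => //; rewrite cD -ltnS -am.
Qed.

(** * The all-ones vector and column sums *)

(** A kernel vector with a zero entry at [k] restricts to the kernel of the nonsingular [B[a :\ k]]
    and so vanishes. A nonzero kernel vector must therefore be all ones. *)
Lemma singular_all_ones (n : nat) (B : 'M['F_2]_n) (a : {set 'I_n}) :
  principal_minor B a = 0 ->
  (forall i, i \in a -> principal_minor B (a :\ i) != 0) ->
  forall j, j \in a -> \sum_(i in a) B i j = 0.
Proof.
move=> a0 nzD j ja.
apply/eqP/negPn/negP => sj; have := erefl (0 : 'F_2); rewrite -{1}a0.
suff nza : principal_minor B a != 0 by move/eqP; rewrite (negPf nza).
apply/principal_minorP => x xB i ia.
have [/existsP[k /andP[ka xk0]]|/existsPn no] :=
    boolP [exists k, (k \in a) && (x k == 0)].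
  have [->|ik] := eqVneq i k; first exact/eqP.
  have /principal_minorP/(_ x) := nzD k ka; apply; last by rewrite !inE ik.
  move=> l; rewrite !inE => /andP[lk la]; have := xB l la.
  rewrite (bigD1 k) //= (eqP xk0) mul0r add0r => xl.
  by rewrite -[RHS]xl; apply: eq_bigl => m; rewrite !inE andbC.
case/eqP: sj; rewrite -[RHS](xB j ja); apply: eq_bigr => k ka.
have := no k; rewrite ka /= => xk.
by case: (F2_cases (x k)) xk => ->; rewrite ?eqxx ?mul1r.
Qed.

(** The sums are all 0 if [B[a]] is singular. Otherwise [minor_setD1] makes the solution of [B[a] v
    = 1] the all-ones vector, and they are all 1. *)
Lemma column_sums_constant (n : nat) (B : 'M['F_2]_n) (a : {set 'I_n}) :
  unit_symmetric B ->
  (forall i, i \in a -> principal_minor B (a :\ i) != 0) ->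
  {in a &, forall j k, \sum_(i in a) B i j = \sum_(i in a) B i k}.
Proof.
move=> usB nzD j k ja ka.
have [a0|nza] := eqVneq (principal_minor B a) 0.
  by rewrite !singular_all_ones.
have [v vB] := principal_solve (fun=> 1) nza.
have sum1 l : l \in a -> \sum_(i in a) B i l = 1.
  move=> la; rewrite -[RHS](vB l la); apply: eq_bigr => i ia.
  by have := minor_setD1 usB nza vB ia; rewrite nzD // => /esym/eqP->; rewrite mul1r.
by rewrite !sum1.
Qed.

(* All principal minors of order m are nonzero: comparing the column sums over
   two sets of order m + 1 which differ in one element shows that every 4-cycle
   of B has sum zero. *)
Lemma four_cycle (n : nat) (B : 'M['F_2]_n) (m : nat) (i j k l : 'I_n) :
  unit_symmetric B -> (2 <= m)%N -> (m.+2 <= n)%N ->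
  (forall a : {set 'I_n}, #|a| = m -> principal_minor B a != 0) ->
  uniq [:: i; j; k; l] ->
  B i k + B j k = B i l + B j l.
Proof.
move=> usB m2 mn nzm; rewrite /= !inE !negb_or !andbT.
case/and3P=> /and3P[ij ik il] /andP[jk jl] kl.
(* A set of order [m] that contains [i] and [j] and avoids [k] and [l] exists because
   [2 <= m <= n - 2]. *)
have [||b [/subsetP sb /subsetP bs bm]] := @exists_card_between _ [set i; j] (~: [set k; l]) m.
- by apply/subsetP => x; rewrite !inE => /orP[]/eqP->; rewrite negb_or ?ik ?il ?jk ?jl.
- by rewrite cards2 ij m2 cardsCs setCK cards2 kl card_ord; lia.
have [ib jb] : i \in b /\ j \in b by split; apply: sb; rewrite !inE eqxx ?orbT.
have [kb lb] : k \notin b /\ l \notin b.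
  by split; apply/negP => /bs; rewrite !inE eqxx ?orbT.
(* Used for [x = k] and [x = l]: the two sums over [b] are common to both equations and cancel. *)
have col x : x \notin b -> \sum_(y in b) B y i + B x i = \sum_(y in b) B y j + B x j.
  move=> xb; have := @column_sums_constant n B (x |: b) usB _ i j.
  rewrite !inE ib jb !orbT !big_setU1 //= ![_ + B x _]addrC; apply=> // y yb.
  apply: nzm; have := cardsD1 y (x |: b).
  by rewrite yb cardsU1 xb bm => -[].
have := col k kb; have := col l lb.
rewrite !(unit_symmetricE i _ usB) !(unit_symmetricE j _ usB).
move: (\sum_(y in b) _) (\sum_(y in b) _) (B k i) (B l i) (B k j) (B l j).
move=> t s ki li kj lj el ek.
have -> : ki = s + (t + kj) by rewrite -ek addrA addF2 add0r.
have -> : li = s + (t + lj) by rewrite -el addrA addF2 add0r.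
by rewrite -!addrA !addF2.
Qed.

(** * Complete bipartite graphs *)

(** One or three edges on a triple give two equal rows, so a nonsingular triple has an even number
    of edges. *)
Lemma triple_minor (n : nat) (B : 'M['F_2]_n) (i j k : 'I_n) :
  unit_symmetric B -> uniq [:: i; j; k] ->
  principal_minor B [set i; j; k] != 0 -> B j k = B i j + B i k.
Proof.
move=> usB; rewrite /= !inE negb_or andbT => /andP[/andP[ij ik] jk] nz.
have [ii ji ki] : [/\ B i i = 1, B j j = 1 & B k k = 1] by rewrite !(proj2 usB).
have sji := unit_symmetricE j i usB; have ski := unit_symmetricE k i usB.
have skj := unit_symmetricE k j usB.
have not_twin x y : x != y -> x \in [set i; j; k] -> y \in [set i; j; k] ->
    ~ (forall l, l \in [set i; j; k] -> B x l = B y l).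
  by move=> xy xa ya eqB; rewrite (twin_minor xa ya xy eqB) eqxx in nz.
have [ia ja ka] : [/\ i \in [set i; j; k], j \in [set i; j; k] & k \in [set i; j; k]].
  by rewrite !inE !eqxx !orbT.
case: (F2_cases (B j k)) => bjk; case: (F2_cases (B i j)) => bij;
  case: (F2_cases (B i k)) => bik; rewrite bjk bij bik ?addF2 ?addr0 ?add0r //.
- case: (not_twin i k) => // l; rewrite !inE -orbA => /or3P[]/eqP->; congruence.
- case: (not_twin i j) => // l; rewrite !inE -orbA => /or3P[]/eqP->; congruence.
- case: (not_twin j k) => // l; rewrite !inE -orbA => /or3P[]/eqP->; congruence.
- case: (not_twin i j) => // l; rewrite !inE -orbA => /or3P[]/eqP->; congruence.
Qed.

Lemma bipartite_of_star (n : nat) (B : 'M['F_2]_n) (i : 'I_n) :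
  unit_symmetric B ->
  (forall j k, uniq [:: i; j; k] -> B j k = B i j + B i k) ->
  exists c : 'I_n -> 'F_2, forall j k, B j k = (j == k)%:R + (c j + c k).
Proof.
(* [c] marks the neighbours of [i]. The value at [i] itself is set to 0, since the diagonal entry
   [B i i] is 1. *)
move=> usB star; exists (fun j => if j == i then 0 else B i j) => j k.
have [<-|jk] := eqVneq j k; first by rewrite addF2 addr0 (proj2 usB).
rewrite add0r; have [ji|ji] := eqVneq j i.
  by rewrite ji add0r eq_sym -ji (negPf jk).
have [ki|ki] := eqVneq k i; first by rewrite ki addr0 (unit_symmetricE _ _ usB).
by apply: star; rewrite /= !inE negb_or !andbT ![i == _]eq_sym ji ki jk.
Qed.

Lemma bipartite_of_epr_term (n : nat) (B : 'M['F_2]_n) (m : nat) :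
  unit_symmetric B -> (3 <= m <= n)%N -> (m == 3%N) || (m.+2 <= n)%N ->
  epr_term B m = lA ->
  exists c : 'I_n -> 'F_2, forall j k, B j k = (j == k)%:R + (c j + c k).
Proof.
move=> usB /andP[m3 mn] m3n /epr_termA nzm.
have [b bm] := exists_set_card mn.
(* Descending from order [m] to order 3 provides one triangle with sum zero, from which all others
   through [i] are reached. *)
have [|b3 b3card nzb3] := nonzero_minor_le usB (nzm b bm) (k := 3).
  by rewrite bm.
have [i [j [k [uijk b3E]]]] :
    exists i j k, uniq [:: i; j; k] /\ b3 = [set i; j; k].
  have /card_gt0P[i ib] : (0 < #|b3|)%N by rewrite b3card.
  have c2 : #|b3 :\ i| == 2%N by have := cardsD1 i b3; rewrite ib b3card add1n => -[<-].
  have /cards2P[j [k [jk jkE]]] := c2.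
  have : i \notin [set j; k] by rewrite -jkE !inE eqxx.
  rewrite !inE => ijk; exists i, j, k; split; first by rewrite /= !inE ijk jk.
  by rewrite -(setD1K ib) jkE setUA.
rewrite {}b3E in nzb3.
have [m3E|m3'] := eqVneq m 3%N.
  apply: (bipartite_of_star (i := i) usB) => x y u; apply: triple_minor => //.
  apply: nzm; move: u; rewrite /= !inE negb_or andbT => /andP[/andP[ix iy] xy].
  by rewrite setUC cardsU1 cards2 !inE negb_or ![y == _]eq_sym iy xy ix m3E.
rewrite (negPf m3') /= in m3n.
have fc := @four_cycle n B m _ _ _ _ usB (ltnW m3) m3n nzm.
(* The 4-cycle relation lets one vertex of a triangle through [i] be exchanged without changing the
   triangle sum. *)
have step x y z : uniq [:: i; x; y] -> uniq [:: i; x; z] ->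
    B x y = B i x + B i y -> B x z = B i x + B i z.
  move=> uy uz xy; have [<-//|yz] := eqVneq y z.
  have := fc i x y z; rewrite xy.
  move: uy uz; rewrite /= !inE !negb_or !andbT.
  move=> /andP[/andP[-> ->] ->] /andP[/andP[_ ->] ->] /(_ yz).
  rewrite [B i x + _]addrC addrA addF2 add0r => ->.
  by rewrite addrAC addF2 add0r.
have star j' k' : uniq [:: i; j'; k'] -> B j' k' = B i j' + B i k'.
  have swap x y : B x y = B i x + B i y -> B y x = B i y + B i x.
    by rewrite (unit_symmetricE y) // addrC.
  have uswap x y : uniq [:: i; x; y] -> uniq [:: i; y; x].
    by rewrite /= !inE !negb_or !andbT [y == x]eq_sym [(i != y) && _]andbC.
  move=> u; have tri := triple_minor usB uijk nzb3.
  (* The route is [{i, j, k}], [{i, j, k'}], [{i, j', k'}]. If [k' = j], the single exchange of [k]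
     for [j'] suffices. *)
  have [k'j|k'j] := eqVneq k' j.
    by rewrite k'j in u *; apply/swap/(step j k) => //; apply: uswap.
  have uj : uniq [:: i; j; k'].
    move: u uijk; rewrite /= !inE !negb_or !andbT [j == k']eq_sym k'j.
    by move=> /andP[/andP[_ ->] _] /andP[/andP[-> _] _].
  by apply/swap/(step k' j); [exact: uswap|exact: uswap|apply/swap/(step j k)].
exact: bipartite_of_star star.
Qed.

(** [B] differs from the identity by a matrix of rank at most 2. A kernel vector thus has the form
    [t + s * c i], where [t] is the sum of [x i * c i] and [s] the sum of [x i], and singularity
    becomes a linear system in [t] and [s]. *)
Lemma bipartite_minor (n : nat) (B : 'M['F_2]_n) (c : 'I_n -> 'F_2)
    (a : {set 'I_n}) :
  (forall j k, B j k = (j == k)%:R + (c j + c k)) ->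
  (principal_minor B a != 0) = odd #|a| || (\sum_(i in a) c i == 0).
Proof.
move=> Bc.
have colE x j : j \in a -> \sum_(i in a) x i * B i j =
    x j + (\sum_(i in a) x i * c i + (\sum_(i in a) x i) * c j).
  move=> ja; rewrite mulr_suml -big_split /=.
  under eq_bigr do rewrite Bc mulrDr mulrDr.
  rewrite big_split /=; congr (_ + _).
  rewrite (bigD1 j) //= eqxx mulr1 big1 ?addr0 // => i /andP[_ /negPf->].
  exact: mulr0.
have sum_const t : \sum_(i in a) t = t * (odd #|a|)%:R :> 'F_2.
  by rewrite -natr_F2 sumr_const mulr_natr.
have kernel x : (forall j, j \in a -> \sum_(i in a) x i * B i j = 0) ->
    exists t s, [/\ forall i, i \in a -> x i = t + s * c i,
      t = (t + s) * \sum_(i in a) c i &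
      s = t * (odd #|a|)%:R + s * \sum_(i in a) c i].
  move=> xB; set t := \sum_(i in a) x i * c i; set s := \sum_(i in a) x i.
  have xE i : i \in a -> x i = t + s * c i.
    move=> ia; have := xB i ia; rewrite colE // -/t -/s => /eqP.
    by rewrite addF2_eq0 => /eqP.
  exists t, s; split=> //; rewrite ?mulr_sumr.
    apply: eq_bigr => i ia; rewrite xE //.
    by case: (F2_cases (c i)) => ->; rewrite ?mulr0 ?mulr1.
  by rewrite -sum_const -big_split; apply: eq_bigr.
have [sum0|sum1] := F2_cases (\sum_(i in a) c i).
  rewrite sum0 eqxx orbT; apply/principal_minorP => x /kernel[t [s []]].
  rewrite sum0 !mulr0 => xE t0; rewrite t0 mul0r addr0 => s0 i ia.
  by rewrite xE // t0 s0 mul0r addr0.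
rewrite sum1 oner_eq0 orbF; have [odda|evena] := boolP (odd #|a|).
  apply/principal_minorP => x /kernel[t [s []]]; rewrite sum1 odda !mulr1.
  move=> xE; case: (F2_cases t) (F2_cases s) xE => -> [] -> xE.
  - by move=> _ _ i /xE; rewrite mul0r addr0.
  - by rewrite add0r => /esym/eqP; rewrite oner_eq0.
  - by rewrite addr0 => _ /esym/eqP; rewrite oner_eq0.
  - by rewrite addF2 => /eqP; rewrite oner_eq0.
(* With [#|a|] even and the sum of [c] equal to 1, the system has the solution [t = 1], [s = 0],
   which is the all-ones vector. *)
apply/negbTE/negP => /principal_minorP/(_ (fun=> 1)).
have [a0|[i ia]] := set_0Vmem a.
  by move: sum1; rewrite a0 big_set0 => /esym/eqP; rewrite oner_eq0.
move=> /(_ _ i ia)/eqP; rewrite oner_eq0 => h; apply: (notF (h _)) => j ja.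
rewrite colE // (eq_bigr c) => [|l _]; last exact: mul1r.
by rewrite sum1 sum_const (negPf evena) mulr0 mul0r addr0 addF2.
Qed.

Lemma epr_bipartite (n : nat) (B : 'M['F_2]_n) (c : 'I_n -> 'F_2)
    (i j : 'I_n) (k : nat) :
  (forall j k, B j k = (j == k)%:R + (c j + c k)) -> c i != c j ->
  (0 < k)%N -> (odd k) || (k < n)%N ->
  epr_term B k = if odd k then lA else lS.
Proof.
move=> Bc; wlog: i j / c i = 0 /\ c j = 1 => [th|[ci cj] _].
  move=> cij; case: (F2_cases (c i)) (F2_cases (c j)) => ci [] cj.
  - by rewrite ci cj eqxx in cij.
  - exact: (th i j).
  - by apply: (th j i); rewrite // eq_sym.
  - by rewrite ci cj eqxx in cij.
move=> k0; case: ifPn => [oddk _|evenk /= kn].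
  by apply/epr_termA => a ak; rewrite (bipartite_minor _ Bc) ak oddk.
have ij : i != j by apply: contra_eq_neq cj => <-; rewrite ci eq_sym oner_eq0.
(* Adding [i] or adding [j] to the same set of order [k - 1] gives sums of [c] of opposite parity,
   hence one zero and one nonzero minor. *)
have [|b [_ /subsetP bs bk]] := @exists_card_between 'I_n set0 (~: [set i; j]) k.-1 (sub0set _).
  by rewrite cards0 cardsCs setCK cards2 ij card_ord; lia.
have [ib jb] : i \notin b /\ j \notin b.
  by split; apply/negP => /bs; rewrite !inE eqxx ?orbT.
have card1 x : x \notin b -> #|x |: b| = k.
  by move=> xb; rewrite cardsU1 xb bk add1n prednK.
have minorE x : x \notin b ->
    (principal_minor B (x |: b) != 0) = (c x + \sum_(l in b) c l == 0).
  by move=> xb; rewrite (bipartite_minor _ Bc) card1 // (negPf evenk) big_setU1.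
have mi := minorE i ib; have mj := minorE j jb; apply/epr_termS.
case: (F2_cases (\sum_(l in b) c l)) => sb.
  split; first by exists (i |: b); rewrite ?card1 // mi sb ci addr0.
  by exists (j |: b); rewrite ?card1 //; apply/eqP; rewrite -[_ == _]negbK mj sb cj addr0 oner_eq0.
split; first by exists (j |: b); rewrite ?card1 // mj sb cj addF2.
by exists (i |: b); rewrite ?card1 //; apply/eqP; rewrite -[_ == _]negbK mi sb ci add0r oner_eq0.
Qed.

(** * Constraints on the letters of a sequence starting with [lA] *)

Lemma epr_term1 (n : nat) (B : 'M['F_2]_n) :
  B^T = B -> epr_term B 1 = lA <-> unit_symmetric B.
Proof.
move=> symB; split=> [/epr_termA nz1|[_ diagB]].
  split=> // i; have := nz1 [set i] (cards1 i).
  case: (F2_cases (B i i)) => // bii /principal_minorP ker.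
  have ones j : j \in [set i] -> \sum_(k in [set i]) 1 * B k j = 0.
    by rewrite inE => /eqP->; rewrite big_set1 bii mulr0.
  by have /eqP := ker (fun=> 1) ones i (set11 i); rewrite oner_eq0.
apply/epr_termA => a /eqP/cards1P[i ->].
by apply: independent_minor => // j k; rewrite !inE => /eqP-> /eqP->; rewrite eqxx.
Qed.

(** An edge makes its two ends twins in the pair they form, so this letter forces [B] to be the
    identity. *)
Lemma epr_term2 (n : nat) (B : 'M['F_2]_n) (k : nat) :
  unit_symmetric B -> epr_term B 2 = lA -> epr_term B k = lA.
Proof.
move=> usB /epr_termA nz2; apply/epr_termA => a _.
apply: independent_minor => [|i j _ _ ij]; first exact: (proj2 usB).
case: (F2_cases (B i j)) => // bij.
have := nz2 [set i; j]; rewrite cards2 ij => /(_ erefl).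
rewrite (@twin_minor _ _ _ _ i j) ?inE ?eqxx ?orbT // => l.
by rewrite !inE => /orP[]/eqP->; rewrite ?bij ?(unit_symmetricE j i usB) ?bij (proj2 usB).
Qed.

Lemma epr_term_order (n : nat) (B : 'M['F_2]_n) :
  epr_term B n = if principal_minor B setT != 0 then lA else lN.
Proof.
have setTE (a : {set 'I_n}) : #|a| = n -> a = setT.
  by move=> an; apply/eqP; rewrite eqEcard subsetT cardsT card_ord an leqnn.
case: ifPn => [nz|/negPn/eqP z].
  by apply/epr_termA => a /setTE->.
by apply/epr_termN => // a /setTE->.
Qed.

Lemma epr_term_neqN (n : nat) (B : 'M['F_2]_n) (a : {set 'I_n}) (k : nat) :
  unit_symmetric B -> principal_minor B a != 0 -> (k <= #|a|)%N ->
  epr_term B k <> lN.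
Proof.
move=> usB nza ka; have kn : (k <= n)%N.
  by apply: leq_trans ka _; rewrite -[X in (_ <= X)%N]card_ord max_card.
have [b bk nzb] := nonzero_minor_le usB nza ka.
by move=> /(epr_termN _ kn)/(_ b bk)/eqP; rewrite (negPf nzb).
Qed.

Lemma epr_termN_le (n : nat) (B : 'M['F_2]_n) (k m : nat) :
  unit_symmetric B -> epr_term B k = lN -> (k <= m <= n)%N ->
  epr_term B m = lN.
Proof.
move=> usB kN /andP[km mn]; apply/epr_termN => // a am.
apply/eqP/negPn/negP => nza; have := @epr_term_neqN _ _ _ k usB nza.
by rewrite am => /(_ km).
Qed.

(** Criterion for the letter [lS] in the realizations: [a] passes a nonzero minor down to order [k],
    and a subset of [b] of order [k] containing the twins has minor zero. *)
Lemma epr_termS_twin (n : nat) (B : 'M['F_2]_n) (a b : {set 'I_n})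
    (i j : 'I_n) (k : nat) :
  unit_symmetric B -> principal_minor B a != 0 -> (k <= #|a|)%N ->
  i \in b -> j \in b -> i != j -> (forall l, l \in b -> B i l = B j l) ->
  (2 <= k <= #|b|)%N -> epr_term B k = lS.
Proof.
move=> usB nza ka ib jb ij eqB kb; apply/epr_termS; split.
  exact: nonzero_minor_le nza ka.
have [||d [/subsetP ijd /subsetP db dk]] := @exists_card_between _ [set i; j] b k.
- by apply/subsetP => l; rewrite !inE => /orP[]/eqP->.
- by rewrite cards2 ij.
exists d => //; apply: (@twin_minor _ _ _ _ i j) => //.
- by apply: ijd; rewrite !inE eqxx.
- by apply: ijd; rewrite !inE eqxx orbT.
- by move=> l /db; apply: eqB.
Qed.

Lemma epr_termAN_even (n : nat) (B : 'M['F_2]_n) :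
  unit_symmetric B -> (0 < n)%N ->
  epr_term B n.-1 = lA -> epr_term B n = lN -> ~~ odd n.
Proof.
move=> usB n0 /epr_termA nzD; rewrite epr_term_order; case: eqP => // zT _.
have col j : \sum_(i in [set: 'I_n]) 1 * B i j = 0.
  under eq_bigr do rewrite mul1r.
  apply: singular_all_ones => // i _; apply: nzD.
  by have := cardsD1 i setT; rewrite cardsT card_ord inE /=; lia.
(* The quadratic form at the all-ones vector is the sum of its entries, which is [n] modulo 2. *)
have := quadratic_form_F2 setT (fun=> 1) usB; rewrite big1 => [|j _]; last first.
  by rewrite col mul0r.
rewrite sumr_const cardsT card_ord natr_F2.
by case: odd => // /esym/eqP; rewrite oner_eq0.
Qed.

(** * Words recovered from their letters *)

Lemma map_iota_rep (f : nat -> epr_letter) (c : epr_letter) (a m : nat) :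
  (forall k, (a <= k < a + m)%N -> f k = c) ->
  [seq f k | k <- iota a m] = rep m [:: c].
Proof.
elim: m a => //= m IH a fc; rewrite fc ?IH //; last by lia.
by move=> k kP; apply: fc; lia.
Qed.

Lemma map_iota_alternating (f : nat -> epr_letter) (a m : nat) :
  ~~ odd a ->
  (forall k, (a <= k < a + m.*2)%N -> f k = if odd k then lA else lS) ->
  [seq f k | k <- iota a m.*2] = rep m [:: lS; lA].
Proof.
elim: m a => //= m IH a evena fc.
rewrite fc ?fc /= ?(negPf evena) /= ?IH //=; try by lia.
by move=> k kP; apply: fc; lia.
Qed.

Lemma form_AN (f : nat -> epr_letter) (m p : nat) :
  f 1%N = lA -> (forall k, (2 <= k <= m.+1)%N -> f k = lS) ->
  (forall k, (m.+2 <= k <= (m + p).+2)%N -> f k = lN) ->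
  [seq f k | k <- iota 1 (m + p).+2] =
  [:: lA] ++ rep m [:: lS] ++ [:: lN] ++ rep p [:: lN].
Proof.
move=> f1 fS fN; rewrite -addnS /= f1 iotaD map_cat /= fN; last by lia.
rewrite (map_iota_rep (c := lS)) ?(map_iota_rep (c := lN)) //.
by move=> k kP; apply: fN; lia.
Qed.

Lemma form_ASS (f : nat -> epr_letter) (m : nat) (t : seq epr_letter) :
  f 1%N = lA -> (forall k, (2 <= k <= m.+3)%N -> f k = lS) ->
  [seq f k | k <- iota m.+4 (size t)] = t ->
  [seq f k | k <- iota 1 (m + size t).+3] =
  [:: lA; lS; lS] ++ rep m [:: lS] ++ t.
Proof.
move=> f1 fS ft; rewrite /= f1 !fS; try by lia.
by rewrite iotaD map_cat ft (map_iota_rep (c := lS)) // => k kP; apply: fS; lia.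
Qed.

Lemma form_ASA (f : nat -> epr_letter) (m : nat) (t : seq epr_letter) :
  (forall k, (1 <= k <= m.*2.+3)%N -> f k = if odd k then lA else lS) ->
  [seq f k | k <- iota m.*2.+4 (size t)] = t ->
  [seq f k | k <- iota 1 (m.*2 + size t).+3] =
  [:: lA; lS; lA] ++ rep m [:: lS; lA] ++ t.
Proof.
move=> fk ft; rewrite /= !fk; try by lia.
by rewrite iotaD map_cat ft map_iota_alternating // => k kP; apply: fk; lia.
Qed.

(** * Matrices realizing the forms *)

Lemma attainable_epr (n : nat) (B : 'M['F_2]_n) (s : seq epr_letter) :
  B^T = B -> (0 < n)%N -> [seq epr_term B k | k <- iota 1 n] = s ->
  attainable 'F_2 s.
Proof.
move=> symB n0 <-; split; last by exists n, B.
by case: n B symB n0.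
Qed.

Lemma attainable_A (m : nat) : attainable 'F_2 ([:: lA] ++ rep m [:: lA]).
Proof.
apply: (@attainable_epr m.+1 1%:M) => //; first exact: trmx1.
rewrite -[RHS]/(rep m.+1 [:: lA]); apply: map_iota_rep => k _.
apply/epr_termA => a _; apply: independent_minor => [i|i j _ _ /negPf ij].
  by rewrite mxE eqxx.
by rewrite mxE ij.
Qed.

Lemma card_ord_lt (n m : nat) : (m <= n)%N -> #|[set i : 'I_n | (i < m)%N]| = m.
Proof.
move=> mn; rewrite -sum1_card (eq_bigl (fun i : 'I_n => (i < m)%N)) => [|i].
  by rewrite (big_ord_narrow mn) sum1_card card_ord.
by rewrite inE.
Qed.

Lemma attainable_ASN (m p : nat) :
  attainable 'F_2 ([:: lA] ++ rep m [:: lS] ++ [:: lN] ++ rep p [:: lN]).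
Proof.
pose n := (m + p).+2.
(* The graph has [m] isolated vertices and a clique on the other [p + 2]. Any two clique vertices
   are twins, so nonsingular sets contain at most one of them and have order at most [m + 1]. *)
pose B : 'M['F_2]_n :=
  \matrix_(i, j) ((i == j) || (m <= i)%N && (m <= j)%N)%:R.
have symB : B^T = B.
  by apply/matrixP => i j; rewrite !mxE eq_sym andbC.
have usB : unit_symmetric B by split=> // i; rewrite mxE eqxx.
have twin (i j : 'I_n) : (m <= i)%N -> (m <= j)%N -> forall l, B i l = B j l.
  move=> mi mj l; rewrite !mxE mi mj /=; case: (leqP m l) => ml; rewrite ?orbT //.
  have neq (k : 'I_n) : (m <= k)%N -> k == l = false.
    by move=> mk; apply: contraTF ml => /eqP<-; rewrite -leqNgt.
  by rewrite !neq.
pose a : {set 'I_n} := [set i : 'I_n | (i < m.+1)%N].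
have nza : principal_minor B a != 0.
  apply: independent_minor => [i|i j]; first exact: (proj2 usB).
  rewrite !inE => im jm ij; rewrite mxE (negPf ij) /=.
  case: leqP => //= mi; case: leqP => //= mj; case/eqP: ij; apply: val_inj => /=.
  by lia.
have acard : #|a| = m.+1 by apply: card_ord_lt; lia.
apply: (attainable_epr symB) => //; apply: form_AN => [|k kP|k kP].
- exact/epr_term1.
- have ltm : (m < n)%N by rewrite /n; lia.
  have ltm1 : (m.+1 < n)%N by rewrite /n; lia.
  apply: (epr_termS_twin (a := a) (b := setT) (i := Ordinal ltm) (j := Ordinal ltm1)) => //.
  + by rewrite acard; lia.
  + by rewrite inE.
  + by rewrite inE.
  + by rewrite -val_eqE /=; lia.
  + by move=> l _; apply: twin => /=; lia.
  + by rewrite cardsT card_ord /n; lia.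
apply/epr_termN => [|b bk]; first by lia.
have /card_gt1P[i [j [ib jb ij]]] : (1 < #|b :\: [set i : 'I_n | (i < m)%N]|)%N.
  have lowm : #|[set i : 'I_n | (i < m)%N]| = m by apply: card_ord_lt; rewrite /n; lia.
  have : (k <= m + #|b :\: [set i : 'I_n | (i < m)%N]|)%N.
    rewrite -bk -(cardsID [set i : 'I_n | (i < m)%N] b) leq_add2r.
    by rewrite -[X in (_ <= X)%N]lowm subset_leq_card ?subsetIr.
  by lia.
move: ib jb; rewrite !inE -!leqNgt => /andP[mi ib] /andP[mj jb].
by apply: (twin_minor ib jb ij) => l _; apply: twin.
Qed.

Lemma eq_principal_minor (F : fieldType) (n : nat) (B C : 'M[F]_n) (a : {set 'I_n}) :
  {in a &, B =2 C} -> principal_minor B a = principal_minor C a.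
Proof.
move=> BC; congr (\det _); apply/matrixP => i j.
by rewrite !mxE BC ?enum_valP.
Qed.

(** [B[b]] is block diagonal, with blocks [B[a]] and an identity matrix. *)
Lemma isolated_minor (n : nat) (B : 'M['F_2]_n) (a b : {set 'I_n}) :
  (forall i, B i i = 1) -> a \subset b ->
  (forall i j, i \in b -> j \in b :\: a -> i != j -> B i j = 0) ->
  principal_minor B a != 0 -> principal_minor B b != 0.
Proof.
move=> diagB /subsetP ab iso nza; apply/principal_minorP => x xB.
have xD j : j \in b :\: a -> x j = 0.
  move=> jD; have jb : j \in b by case/setDP: jD.
  rewrite -[RHS](xB j jb) (bigD1 j) //= diagB mulr1 big1 ?addr0 // => i /andP[ib ij].
  by rewrite iso // mulr0.
move=> i ib; have [ia|ia] := boolP (i \in a); last by apply: xD; rewrite inE ia.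
move/principal_minorP: nza => /(_ x); apply=> // j ja.
rewrite -[RHS](xB j (ab j ja)) [RHS](bigID (mem a)) /= [X in _ + X]big1 ?addr0.
  apply: eq_bigl => k; rewrite andbC; symmetry; apply: andb_idr; exact: ab.
by move=> k /andP[kb ka]; rewrite xD ?mul0r // inE ka.
Qed.

(* The path 0-1-2 (q = 3) or the cycle 0-1-2-3 (q = 4), and isolated vertices. *)
Definition small_graph (q n : nat) : 'M['F_2]_n :=
  \matrix_(i, j) ((i == j)%:R +
    if (i < q)%N && (j < q)%N then (odd i)%:R + (odd j)%:R else 0).

Lemma small_graph_unit (q n : nat) : unit_symmetric (small_graph q n).
Proof.
split=> [|i]; last by rewrite mxE eqxx addF2 if_same addr0.
apply/matrixP => i j; rewrite !mxE eq_sym andbC; congr (_ + _).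
by case: ifP => // _; rewrite addrC.
Qed.

(** After the isolated vertices are dropped, the graph is complete bipartite, with the parity of the
    index as colouring. *)
Lemma small_graph_minor (q n : nat) (b : {set 'I_n}) :
  odd #|[set i in b | (i < q)%N]| ||
    (\sum_(i in b | (i < q)%N) (odd i)%:R == 0 :> 'F_2) ->
  principal_minor (small_graph q n) b != 0.
Proof.
move=> h; pose a := [set i in b | (i < q)%N].
apply: (@isolated_minor _ _ a).
- exact: (proj2 (small_graph_unit q n)).
- by apply/subsetP => i; rewrite inE => /andP[].
- move=> i j ib; rewrite !inE => /andP[+ jb] ij; rewrite jb /= => jq.
  by rewrite mxE (negPf ij) (negPf jq) andbF addr0.
pose C : 'M['F_2]_n := \matrix_(i, j) ((i == j)%:R + ((odd i)%:R + (odd j)%:R)).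
rewrite (@eq_principal_minor _ _ _ C) => [|i j]; last first.
  by rewrite !inE => /andP[_ iq] /andP[_ jq]; rewrite !mxE iq jq.
rewrite (@bipartite_minor _ _ (fun i => (odd i)%:R)) => [|i j]; last by rewrite mxE.
case/orP: h => [->//|/eqP s0]; apply/orP; right; apply/eqP; rewrite -[RHS]s0.
by apply: eq_bigl => i; rewrite !inE.
Qed.

Lemma small_graph_minorT (q n : nat) :
  (q == 3%N) || (q == 4%N) -> (q <= n)%N ->
  principal_minor (small_graph q n) setT != 0.
Proof.
move=> q34 qn; apply: small_graph_minor; case/orP: q34 => /eqP qE.
  apply/orP; left; rewrite (_ : [set i in setT | _] = [set i : 'I_n | (i < q)%N]).
    by rewrite card_ord_lt // qE.
  by apply/setP => i; rewrite !inE.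
apply/orP; right; rewrite (eq_bigl (fun i : 'I_n => (i < q)%N)) => [|i]; last first.
  by rewrite !inE.
rewrite (big_ord_narrow qn); subst q.
by rewrite !big_ord_recl big_ord0.
Qed.

Lemma small_graphS (q n k : nat) :
  (q == 3%N) || (q == 4%N) -> (q <= n)%N -> (2 <= k <= n - (q - 2))%N ->
  epr_term (small_graph q n) k = lS.
Proof.
move=> q34 qn kP; have q3 : (3 <= q)%N by lia.
have lt0 : (0 < n)%N by lia.
have lt1 : (1 < n)%N by lia.
(* Without the vertices from 2 to [q - 1], the edge 0-1 is a component and its ends are twins. The
   [n - (q - 2)] remaining vertices give the upper bound on [k]. *)
pose mid := [set i : 'I_n | (i < q)%N] :\: [set i : 'I_n | (i < 2)%N].
have midc : #|mid| = (q - 2)%N.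
  rewrite cardsD (setIidPr _) ?card_ord_lt //.
  by apply/subsetP => i; rewrite !inE; lia.
apply: (epr_termS_twin (a := setT) (b := ~: mid) (i := Ordinal lt0) (j := Ordinal lt1)).
- exact: small_graph_unit.
- exact: small_graph_minorT.
- by rewrite cardsT card_ord; lia.
- by rewrite !inE.
- by rewrite !inE.
- by [].
- move=> l; rewrite !inE negb_and negbK !mxE -!val_eqE /= => lP.
  have -> : (0 < q)%N by lia.
  have -> : (1 < q)%N by lia.
  case: l lP => -[|[|l]] ltl /=; rewrite ?addr0 ?add0r ?addF2 //.
  - by move=> _; rewrite if_same addr0; have -> : (0 < q)%N by lia.
  - by move=> _; rewrite if_same addr0; have -> : (1 < q)%N by lia.
  - by move=> /negPf->.
- by rewrite cardsCs setCK midc card_ord.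
Qed.

Lemma small_graph_order (q n : nat) :
  (q == 3%N) || (q == 4%N) -> (q <= n)%N -> epr_term (small_graph q n) n = lA.
Proof. by move=> q34 qn; rewrite epr_term_order small_graph_minorT. Qed.

Lemma epr_term_pred (n : nat) (B : 'M['F_2]_n) :
  (0 < n)%N -> (forall i, principal_minor B (setT :\ i) != 0) ->
  epr_term B n.-1 = lA.
Proof.
move=> n0 nzD; apply/epr_termA => a an.
have /cards1P[i ai] : #|~: a| == 1%N by rewrite cardsCs setCK an card_ord; lia.
by rewrite -[a]setCK ai -setTD.
Qed.

(** Deleting a vertex of the cycle leaves a path of odd order 3. Deleting an isolated vertex leaves
    the 4-cycle, both of whose parts are even. *)
Lemma small_graph4_minorD1 (n : nat) (i : 'I_n) :
  (4 <= n)%N -> principal_minor (small_graph 4 n) (setT :\ i) != 0.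
Proof.
move=> n4; apply: small_graph_minor; case: (ltnP i 4) => i4.
  apply/orP; left; rewrite (_ : [set j in _ | _] = [set j : 'I_n | (j < 4)%N] :\ i).
    have := cardsD1 i [set j : 'I_n | (j < 4)%N].
    by rewrite card_ord_lt // inE i4 add1n => -[<-].
  by apply/setP => j; rewrite !inE andbT.
apply/orP; right; rewrite (eq_bigl (fun j : 'I_n => (j < 4)%N)) => [|j]; last first.
  by rewrite !inE andbT; apply: andb_idl => j4; apply: contraTneq j4 => ->; rewrite -leqNgt.
by rewrite (big_ord_narrow n4) !big_ord_recl big_ord0.
Qed.

Lemma attainable_ASSA (m : nat) :
  attainable 'F_2 ([:: lA; lS; lS] ++ rep m [:: lS] ++ [:: lA]).
Proof.
have [symB _] := small_graph_unit 3 (m + 1).+3.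
apply: (attainable_epr symB) => //; apply: (@form_ASS _ m [:: lA]) => [|k kP|/=].
- exact/epr_term1/small_graph_unit.
- by apply: small_graphS => //; lia.
by rewrite -[X in epr_term _ X]/(1 + m).+3 addnC small_graph_order //; lia.
Qed.

Lemma attainable_ASSAA (m : nat) :
  attainable 'F_2 ([:: lA; lS; lS] ++ rep m [:: lS] ++ [:: lA; lA]).
Proof.
have [symB _] := small_graph_unit 4 (m + 2).+3.
apply: (attainable_epr symB) => //; apply: (@form_ASS _ m [:: lA; lA]) => [|k kP|/=].
- exact/epr_term1/small_graph_unit.
- by apply: small_graphS => //; lia.
congr [:: _; _].
  have <- : (m + 2).+3.-1 = m.+4 by lia.
  by apply: epr_term_pred => // i; apply: small_graph4_minorD1; lia.
by rewrite -[X in epr_term _ X]/(2 + m).+3 addnC small_graph_order //; lia.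
Qed.

(** The all-ones vector lies in the kernel of [B[a]], and nonsingularity of [B[a :\ c]] makes it
    span that kernel. A kernel vector of [B[a :\ i]], extended by 0, is then constant and hence
    zero. *)
Lemma minor_setD1_transfer (n : nat) (B : 'M['F_2]_n) (a : {set 'I_n}) (i c : 'I_n) :
  unit_symmetric B -> c \in a -> i \in a ->
  (forall j, j \in a -> \sum_(k in a) B k j = 0) ->
  principal_minor B (a :\ c) != 0 -> principal_minor B (a :\ i) != 0.
Proof.
move=> usB ca ia col0 nzc; apply/principal_minorP => x xB.
pose y j := if j == i then 0 else x j.
have yBj j : j \in a -> j != i -> \sum_(k in a) y k * B k j = 0.
  by move=> ja ji; rewrite sum_zero_extension // xB // !inE ji.
have yB0 j : j \in a -> \sum_(k in a) y k * B k j = 0.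
  move=> ja; have [->|] := eqVneq j i; last exact: yBj.
  (* All column sums vanish, so the entries of [yB] add up to 0, and the one at [i] vanishes with
     the others. *)
  have := bilinear_form_F2 a y (fun=> 1) usB; rewrite (bigD1 i) //= mulr1.
  rewrite [X in _ + X = _]big1 => [|k /andP[ka ki]]; last by rewrite yBj ?mul0r.
  rewrite addr0 => ->; rewrite big1 // => k ka.
  under eq_bigr do rewrite mul1r.
  by rewrite col0 ?mul0r.
have yc j : j \in a -> y j = y c.
  move=> ja; have [->//|jc] := eqVneq j c.
  (* Subtracting the constant [y c] keeps the vector in the kernel and makes it vanish at [c]. *)
  have /principal_minorP/(_ (fun k => y k + y c)) := nzc.
  move=> ker; suff /eqP : y j + y c = 0.
    by rewrite addF2_eq0 => /eqP.
  apply: ker; last by rewrite !inE jc.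
  move=> k; rewrite !inE => /andP[kc ka].
  have := yB0 k ka; have := col0 k ka.
  move=> /(congr1 (fun z => y c * z)); rewrite mulr0 mulr_sumr => s1 s2.
  have : \sum_(l in a) (y l + y c) * B l k = 0.
    by under eq_bigr do rewrite mulrDl; rewrite big_split /= s1 s2 addr0.
  rewrite (bigD1 c) //= addF2 mul0r add0r => s3; rewrite -[RHS]s3.
  by apply: eq_bigl => l; rewrite !inE andbC.
move=> j; rewrite !inE => /andP[ji ja].
have := yc j ja; rewrite -(yc i ia) /y eqxx (negPf ji); exact.
Qed.

(* The cone with apex 4 over the graph C_4 + isolated vertices. *)
Definition cone_graph (n : nat) : 'M['F_2]_n :=
  \matrix_(i, j) if (i == 4%N :> nat) || (j == 4%N :> nat) then 1
                 else small_graph 4 n i j.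

Lemma cone_graph_unit (n : nat) : unit_symmetric (cone_graph n).
Proof.
have usB := small_graph_unit 4 n.
split=> [|i]; last by rewrite mxE (proj2 usB) if_same.
by apply/matrixP => i j; rewrite [LHS]mxE [LHS]mxE [RHS]mxE orbC (unit_symmetricE j i usB).
Qed.

Lemma cone_graph_column_sum (n : nat) (j : 'I_n) :
  (5 <= n)%N -> ~~ odd n -> \sum_i cone_graph n i j = 0.
Proof.
move=> n5 evenn; have [j4|j4] := eqVneq (j : nat) 4%N.
  under eq_bigr do rewrite mxE j4 eqxx orbT.
  by rewrite sumr_const card_ord natr_F2 (negPf evenn).
pose i4 := Ordinal n5; have ji4 : j != i4 by rewrite -val_eqE.
rewrite (bigD1 i4) //= mxE /= (bigD1 j) //= (proj2 (cone_graph_unit n)).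
(* The apex entry and the diagonal entry cancel. What remains is nothing outside the cycle, and two
   neighbours on it. *)
rewrite addrA addF2 add0r; case: (ltnP j 4) => lej; last first.
  rewrite big1 // => i /andP[ii4 ij]; move: (ii4); rewrite -val_eqE => /negPf/= i4F.
  by rewrite !mxE i4F (negPf j4) (negPf ij) /= [(j < 4)%N]ltnNge lej andbF addr0.
rewrite (eq_bigr (fun i : 'I_n => if (i < 4)%N then (odd i)%:R + (odd j)%:R else 0)).
  rewrite -big_mkcondr.
  have -> : \sum_(i < n | (i != i4) && (i != j) && (i < 4)%N) ((odd i)%:R + (odd j)%:R)
     = \sum_(i < n | (i < 4)%N) ((odd i)%:R + (odd j)%:R) :> 'F_2.
    rewrite [RHS](bigD1 j) //= addF2 add0r; apply: eq_bigl => i.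
    rewrite andbC; case: ltnP => //= i4'; rewrite -!val_eqE /=.
    by have -> : (i : nat) != 4%N by lia.
  rewrite (big_ord_narrow (ltnW n5)) !big_ord_recl big_ord0 /=.
  by case: odd; apply/val_inj.
move=> i /andP[ii4 ij]; rewrite !mxE (negPf ij) add0r lej andbT (negPf j4) orbF.
by move: ii4; rewrite -val_eqE => /negPf/= ->.
Qed.

Lemma attainable_ASSSAN (m : nat) :
  ~~ odd m -> attainable 'F_2 ([:: lA; lS; lS; lS] ++ rep m [:: lS] ++ [:: lA; lN]).
Proof.
move=> evenm; pose n := (m.+1 + 2).+3; pose B := cone_graph n.
have usB := cone_graph_unit n; have [symB _] := usB.
have lt4 : (4 < n)%N by rewrite /n; lia.
pose c4 := Ordinal lt4.
have col j : \sum_i B i j = 0 by apply: cone_graph_column_sum => //; rewrite /n; lia.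
have colT j : \sum_(i in setT) B i j = 0.
  by rewrite -[RHS](col j); apply: eq_bigl => i; rewrite inE.
have nzc : principal_minor B (setT :\ c4) != 0.
  (* Removing the apex leaves the 4-cycle with isolated vertices. The transfer lemma carries
     nonsingularity to every other deletion. *)
  rewrite (@eq_principal_minor _ _ _ (small_graph 4 n)) ?small_graph4_minorD1 //.
  by move=> i j; rewrite !inE -!val_eqE !andbT mxE /= => /negPf-> /negPf->.
have nzD i : principal_minor B (setT :\ i) != 0.
  by apply: (minor_setD1_transfer usB _ _ _ nzc).
have zT : principal_minor B setT = 0.
  apply/eqP/negPn/negP => /principal_minorP/(_ (fun=> 1)) ker.
  have ones j : j \in [set: 'I_n] -> \sum_(i in [set: 'I_n]) 1 * B i j = 0.
    by move=> _; under eq_bigr do rewrite mul1r.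
  by have /eqP := ker ones c4 (in_setT _); rewrite oner_eq0.
apply: (attainable_epr symB) => //.
apply: (@form_ASS _ m.+1 [:: lA; lN]) => [|k kP|/=].
- exact/epr_term1.
- have lt0 : (0 < n)%N by [].
  have lt1 : (1 < n)%N by [].
  have lt2 : (2 < n)%N by [].
  have lt3 : (3 < n)%N by [].
  (* Outside vertices 2 and 3, the adjacent vertices 0 and 1 have the apex as their only other
     neighbour, so they are twins in a set of order [n - 2]. *)
  pose b := ~: [set Ordinal lt2; Ordinal lt3].
  apply: (epr_termS_twin (a := setT :\ c4) (b := b) (i := Ordinal lt0) (j := Ordinal lt1)) => //.
  + by rewrite setTD cardsCs setCK cards1 card_ord /n; lia.
  + by rewrite !inE.
  + by rewrite !inE.
  + move=> l; rewrite !inE -!val_eqE /= negb_or !mxE -!val_eqE /=.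
    by case: l => -[|[|[|[|[|l]]]]] ltl //= _; apply/val_inj.
  + by rewrite /b cardsCs setCK card_ord cards2 -val_eqE /= /n; lia.
congr [:: _; _].
  have <- : n.-1 = m.+1.+4 by rewrite /n; lia.
  exact: epr_term_pred.
have -> : m.+1.+4.+1 = n by rewrite /n; lia.
by rewrite epr_term_order zT eqxx.
Qed.

(** For [p <= n] this is the identity plus the adjacency matrix of the complete bipartite graph with
    parts of sizes [p] and [n - p]. For even [n] the parity of [p] decides the last letter. *)
Definition bipartite_graph (p n : nat) : 'M['F_2]_n :=
  \matrix_(i, j) ((i == j)%:R + ((i < p)%N%:R + (j < p)%N%:R)).

Lemma bipartite_graph_sym (p n : nat) : (bipartite_graph p n)^T = bipartite_graph p n.
Proof. by apply/matrixP => i j; rewrite !mxE eq_sym [X in _ + X]addrC. Qed.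

Lemma bipartite_graph_epr (p n k : nat) :
  (0 < p < n)%N -> (0 < k)%N -> odd k || (k < n)%N ->
  epr_term (bipartite_graph p n) k = if odd k then lA else lS.
Proof.
move=> /andP[p0 pn]; have n0 : (0 < n)%N by lia.
apply: (@epr_bipartite _ _ (fun i : 'I_n => (i < p)%N%:R) (Ordinal n0) (Ordinal pn)).
  by move=> i j; rewrite mxE.
by rewrite /= p0 ltnn oner_eq0.
Qed.

Lemma bipartite_graph_order (p n : nat) :
  (p <= n)%N -> ~~ odd n ->
  epr_term (bipartite_graph p n) n = if odd p then lN else lA.
Proof.
move=> pn evenn; rewrite epr_term_order.
rewrite (@bipartite_minor _ _ (fun i : 'I_n => (i < p)%N%:R)); last first.
  by move=> i j; rewrite mxE.
rewrite cardsT card_ord (negPf evenn) /=.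
have -> : \sum_(i in [set: 'I_n]) (i < p)%N%:R = \sum_(i < n | (i < p)%N) 1 :> 'F_2.
  rewrite [RHS]big_mkcond; apply: eq_big => [i|i _]; first by rewrite inE.
  by case: ltnP.
rewrite (big_ord_narrow pn) sumr_const card_ord natr_F2.
by case: odd; rewrite ?oner_eq0 ?eqxx.
Qed.

Lemma attainable_ASA (m : nat) :
  attainable 'F_2 ([:: lA; lS; lA] ++ rep m [:: lS; lA]).
Proof.
rewrite -[rep m _]cats0.
apply: (attainable_epr (bipartite_graph_sym 1 (m.*2 + 0).+3)) => //.
by apply: (@form_ASA _ m [::]) => // k kP; apply: bipartite_graph_epr => //; lia.
Qed.

Lemma attainable_ASAA (m : nat) :
  attainable 'F_2 ([:: lA; lS; lA] ++ rep m [:: lS; lA] ++ [:: lA]).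
Proof.
apply: (attainable_epr (bipartite_graph_sym 2 (m.*2 + 1).+3)) => //.
apply: (@form_ASA _ m [:: lA]) => [k kP|/=]; first by apply: bipartite_graph_epr => //; lia.
by rewrite -[m.*2.+4]/(1 + m.*2).+3 addnC bipartite_graph_order //; lia.
Qed.

Lemma attainable_ASAN (m : nat) :
  attainable 'F_2 ([:: lA; lS; lA] ++ rep m [:: lS; lA] ++ [:: lN]).
Proof.
apply: (attainable_epr (bipartite_graph_sym 1 (m.*2 + 1).+3)) => //.
apply: (@form_ASA _ m [:: lN]) => [k kP|/=]; first by apply: bipartite_graph_epr => //; lia.
by rewrite -[m.*2.+4]/(1 + m.*2).+3 addnC bipartite_graph_order //; lia.
Qed.

(** * Classification of the words and conclusion *)

Lemma size_rep1 (m : nat) (c : epr_letter) : size (rep m [:: c]) = m.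
Proof. by elim: m => //= m ->. Qed.

(** The combinatorial half of necessity: the matrix enters only through the constraints on [f]. The
    cases are split by [f 2], then by [f 3], then by the first later letter other than [lS]. *)
Lemma epr_word_forms (n : nat) (f : nat -> epr_letter) :
  (0 < n)%N -> f 1%N = lA -> f n <> lS ->
  (forall k, f 2%N = lA -> f k = lA) ->
  (forall k m, f k = lN -> (k <= m <= n)%N -> f m = lN) ->
  (f n.-1 = lA -> f n = lN -> ~~ odd n) ->
  (forall m, (3 <= m <= n)%N -> (m == 3%N) || (m.+2 <= n)%N ->
   f 2%N = lS -> f m = lA ->
   forall k, (0 < k)%N -> odd k || (k < n)%N -> f k = if odd k then lA else lS) ->
  let s := [seq f k | k <- iota 1 n] in
  (exists m : nat, s = [:: lA] ++ rep m [:: lA]) \/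
  (exists m p : nat, s = [:: lA] ++ rep m [:: lS] ++ [:: lN] ++ rep p [:: lN]) \/
  (exists m : nat, s = [:: lA; lS; lS] ++ rep m [:: lS] ++ [:: lA]) \/
  (exists m : nat, s = [:: lA; lS; lS] ++ rep m [:: lS] ++ [:: lA; lA]) \/
  ((exists m : nat, s = [:: lA; lS; lS; lS] ++ rep m [:: lS] ++ [:: lA; lN]) /\
   ~~ odd n) \/
  (exists m : nat, s = [:: lA; lS; lA] ++ rep m [:: lS; lA]) \/
  (exists m : nat, s = [:: lA; lS; lA] ++ rep m [:: lS; lA] ++ [:: lA]) \/
  (exists m : nat, s = [:: lA; lS; lA] ++ rep m [:: lS; lA] ++ [:: lN]).
Proof.
move=> n0 f1 fn fA fN feven fbip s; rewrite {}/s.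
have [n1|n2] := leqP n 1%N.
  left; exists 0%N; have -> : n = 1%N by lia.
  by rewrite /= f1.
case f2: (f 2%N).
- left; exists n.-1; have nE : n = (n.-1).+1 by lia.
  rewrite {1}nE -[RHS]/(rep n.-1.+1 [:: lA]); apply: map_iota_rep => k _.
  exact: fA.
- right; have n3 : (3 <= n)%N.
    by case: (ltnP 2 n) => // nle; case: fn; have -> : n = 2%N by lia.
  have [f3|f3] : f 3%N = lA \/ f 3%N <> lA.
    by case: (f 3%N); [left|right|right].
    have fk := fbip 3%N n3 isT f2 f3.
    have := odd_double_half (n - 3); set q := (n - 3)./2; case: odd => /= nE.
    * have {nE} nE : n = (q.*2 + 1).+3 by lia.
      have fkq k : (1 <= k <= q.*2.+3)%N -> f k = if odd k then lA else lS.
        by move=> kP; apply: fk; lia.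
      right; right; right; right; right.
      case fnE: (f n) fn => // _; [left|right]; exists q.
      + rewrite {1}nE; apply: (@form_ASA _ q [:: lA]) => //=.
        by rewrite -[q.*2.+4]/(1 + q.*2).+3 addnC -nE fnE.
      + rewrite {1}nE; apply: (@form_ASA _ q [:: lN]) => //=.
        by rewrite -[q.*2.+4]/(1 + q.*2).+3 addnC -nE fnE.
    * right; right; right; right; left; exists q.
      have {nE} nE : n = (q.*2 + 0).+3 by lia.
      rewrite {1}nE -[rep q _]cats0; apply: (@form_ASA _ q [::]) => // k kP.
      by apply: fk; lia.
  (* Position [n] qualifies because the last letter is never [lS]. The least such [k] ends the
     initial run of [lS]. *)
  pose P k := (2 <= k <= n)%N && if f k is lS then false else true.
  have exP : exists k, P k by exists n; rewrite /P n2 leqnn; case: (f n) fn.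
  case: (ex_minnP exP) => k /andP[/andP[k2 kn] fk] kmin.
  have fS l : (2 <= l < k)%N -> f l = lS.
    move=> /andP[l2 lk]; case fl: (f l) => //; exfalso;
      by have := kmin l; rewrite /P fl l2 /= andbT => /(_ (leq_trans (ltnW lk) kn)); lia.
  have k3 : (3 <= k)%N.
    by rewrite ltn_neqAle k2 andbT; apply/eqP => k2E; rewrite -k2E f2 in fk.
  case fkE: (f k) fk => // _.
    have k4 : (4 <= k)%N.
      by rewrite ltn_neqAle k3 andbT; apply/eqP => k3E; rewrite -k3E in fkE.
    (* An [lA] at [k <= n - 2] would force the alternating pattern and so [f 3 = lA]. *)
    have kn1 : (n <= k.+1)%N.
      rewrite leqNgt; apply/negP => kn1; case: f3.
      by rewrite (fbip k _ _ f2 fkE 3%N) ?k3 ?kn ?kn1 ?orbT.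
    right; have [nk|nk] : n = k \/ n = k.+1 by lia.
      left; exists (k - 4)%N; have nE : n = (k - 4 + 1).+3 by lia.
      rewrite {1}nE; apply: (@form_ASS _ _ [:: lA]) => [//|l lP|/=].
        by apply: fS; lia.
      have -> : (k - 4).+4 = k by lia.
      by rewrite fkE.
    have kE : k = n.-1 by rewrite nk.
    case fnE: (f n) fn => // _.
      right; left; exists (k - 4)%N; have nE : n = (k - 4 + 2).+3 by lia.
      rewrite {1}nE; apply: (@form_ASS _ _ [:: lA; lA]) => [//|l lP|/=].
        by apply: fS; lia.
      have -> : (k - 4).+4 = k by lia.
      by rewrite -nk fkE fnE.
    have evenn : ~~ odd n by apply: feven => //; rewrite -kE.
    right; right; left; split=> //; exists (k - 5)%N.
    (* Here [n = k + 1] is even, so [k] is odd and [k >= 4] improves to 5, which supplies the third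
       [lS]. *)
    have k5 : (5 <= k)%N by lia.
    have nE : n = ((k - 5).+1 + 2).+3 by lia.
    rewrite {1}nE; apply: (@form_ASS _ _ [:: lA; lN]) => [//|l lP|/=].
      by apply: fS; lia.
    have -> : (k - 5).+1.+4 = k by lia.
    by rewrite -nk fkE fnE.
  left; exists (k - 2)%N, (n - k)%N; have nE : n = (k - 2 + (n - k)).+2 by lia.
  rewrite {1}nE; apply: form_AN => // l lP; first by apply: fS; lia.
  by apply: (fN k l fkE); lia.
right; left; exists 0%N, (n - 2)%N; have nE : n = (0 + (n - 2)).+2 by lia.
rewrite {1}nE; apply: form_AN => // l lP; first by lia.
by apply: (fN 2%N l f2); lia.
Qed.

Theorem theorem3p8 (n : nat) (s : seq epr_letter) (size_s : size s = n)
    (head_s : ohead s = Some lA) :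
  attainable 'F_2 s <->
  (exists m : nat, s = [:: lA] ++ rep m [:: lA]) \/
  (exists m p : nat, s = [:: lA] ++ rep m [:: lS] ++ [:: lN] ++ rep p [:: lN]) \/
  (exists m : nat, s = [:: lA; lS; lS] ++ rep m [:: lS] ++ [:: lA]) \/
  (exists m : nat, s = [:: lA; lS; lS] ++ rep m [:: lS] ++ [:: lA; lA]) \/
  ((exists m : nat, s = [:: lA; lS; lS; lS] ++ rep m [:: lS] ++ [:: lA; lN]) /\
   ~~ odd n) \/
  (exists m : nat, s = [:: lA; lS; lA] ++ rep m [:: lS; lA]) \/
  (exists m : nat, s = [:: lA; lS; lA] ++ rep m [:: lS; lA] ++ [:: lA]) \/
  (exists m : nat, s = [:: lA; lS; lA] ++ rep m [:: lS; lA] ++ [:: lN]).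
Proof.
split; last first.
  case=> [[m ->]|]; first exact: attainable_A.
  case=> [[m [p ->]]|]; first exact: attainable_ASN.
  case=> [[m ->]|]; first exact: attainable_ASSA.
  case=> [[m ->]|]; first exact: attainable_ASSAA.
  case=> [[[m sE] evenn]|].
    (* The length is [m + 6], so [m] has the parity of [n]. *)
    move: evenn; rewrite -size_s sE /= size_cat size_rep1 addn2 /= !negbK.
    exact: attainable_ASSSAN.
  case=> [[m ->]|]; first exact: attainable_ASA.
  by case=> [[m ->]|[m ->]]; [exact: attainable_ASAA|exact: attainable_ASAN].
case=> _ [n' [B [symB]]] sE; have n'E : n' = n by rewrite -size_s -sE size_map size_iota.
subst n'; rewrite -{}sE /epr in head_s *; move: size_s => _.
have n0 : (0 < n)%N by case: n B symB head_s.
have f1 : epr_term B 1 = lA by case: n B symB head_s n0 => //= k B _ [].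
have usB : unit_symmetric B by apply/epr_term1.
apply: epr_word_forms => //.
- by rewrite epr_term_order; case: ifP.
- by move=> k; apply: epr_term2.
- by move=> k m; apply: epr_termN_le.
- exact: epr_termAN_even.
move=> m mn m3 f2 fm; have [c Bc] := bipartite_of_epr_term usB mn m3 fm.
have [/existsP[i /existsP[j cij]] k|/existsPn ceq] :=
    boolP [exists i, exists j, c i != c j]; first exact: epr_bipartite Bc cij.
(* If [c] is constant, its sum over any pair is 0, so all minors of order 2 are nonzero, against
   [f2]. *)
suff : epr_term B 2 = lA by rewrite f2.
apply/epr_termA => a a2; rewrite (bipartite_minor _ Bc) a2 /=.
have /card_gt0P[i ia] : (0 < #|a|)%N by rewrite a2.
rewrite (eq_bigr (fun=> c i)) ?sumr_const ?a2 ?mulr2n ?addF2 // => j ja.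
by have /existsPn/(_ j)/negPn/eqP := ceq i.
Qed.
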